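(* Let $(w_1^h,w_2^h)$, with $w_1^h(\cdot,t),w_2^h(\cdot,t)\in V_q^h$ for each $t\in[0,T]$ and differentiable in $t$, solve the semi-discrete DG scheme described in the context for the semi-linear hyperbolic system $$\partial_t w_1=\partial_x w_1-N(w_1,w_2)w_2,\qquad \partial_t w_2=-\partial_x w_2+N(w_1,w_2)w_1,$$ on $I=[x_a,x_b]$ with physical boundary conditions $w_1(x_b,t)=0$, $w_2(x_a,t)=0$, $t\in(0,T]$, using the numerical fluxes at interelement and physical boundaries given in the context with flux parameters $\alpha_1,\alpha_2,\beta_1,\beta_2$. Then the discrete energy $$E^h(t)=\sum_{j=1}^{M}\frac12\int_{I_j}\big((w_1^h)^2+(w_2^h)^2\big)\,dx$$ satisfies $$\frac{dE^h}{dt}=\frac12\sum_{j=1}^{M-1}\Big(-(1-\alpha_1)[w_1^h]^2-(1-\alpha_2)[w_2^h]^2+(\beta_1-\beta_2)[w_1^h][w_2^h]\Big)\Big|_{j+\frac12}$$ $$\qquad-\frac12\Big((w_1^{h,+})^2\big|_{\frac12}+(w_2^{h,+})^2\big|_{\frac12}+(w_1^{h,-})^2\big|_{M+\frac12}+(w_2^{h,-})^2\big|_{M+\frac12}\Big).$$ If moreover the parameters satisfy $$0\le\alpha_1,\alpha_2\le1,\qquad \beta_1,\beta_2\in\mathbb{R},\qquad -(1-\max\{\alpha_1,\alpha_2\})+\frac{|\beta_1-\beta_2|}{2}\le0,$$ then $E^h(t)\le E^h(0)$ for $t\in[0,T]$.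
   Context: **Nonlinearity.** $N(w_1,w_2)=N\big(\sqrt{w_1^2+w_2^2}\big)$ is real-valued, where the function $N(r)$, $r\ge0$, satisfies $N(0)=1$, $N(1)=0$, $N'(r)<0$, and $N(r)\to N_\infty<0$ as $r\to+\infty$. **Mesh and spaces.** $I=[x_a,x_b]$ is partitioned by $x_a=x_{1/2}<x_{3/2}<\dots<x_{M+1/2}=x_b$ into $M$ elements $I_j=(x_{j-1/2},x_{j+1/2})$; $h_j=x_{j+1/2}-x_{j-1/2}$, $h=\max_j h_j$, with $h/\min_j h_j<\zeta$ for a fixed $\zeta>0$. For an integer $q\ge0$, $V_q^h$ is the space of functions whose restriction to each $I_j$ is a polynomial of degree at most $q$ (element of $\mathcal P^q(I_j)$), with no continuity across elements. One-sided limits are $v^{\pm}(x)=\lim_{\epsilon\to0^\pm}v(x+\epsilon)$, and $|_{j+\frac12}$ means evaluation at $x_{j+1/2}$. At interior nodes the jump is $[v]=v^--v^+$ and the average is $\{v\}=\frac12(v^-+v^+)$. **Quadrature.** On each $I_j$ a quadrature rule with nodes $x_{k,j}\in I_j$ and weights $\underline\omega_{k,j}>0$ is fixed, such that for all $j$ and all $\phi\in\mathcal P^q(I_j)$, $\sum_k\underline\omega_{k,j}\phi^2(x_{k,j})=\int_{I_j}\phi^2\,dx$, and $$\sum_j\Big|\sum_k\underline\omega_{k,j}\phi(x_{k,j})f(x_{k,j})-\int_{I_j}\phi f\,dx\Big|\le C_0h^{q+1}\|\phi\|_{L^2(I)}|f|_{H^{q+1}(I)}$$ for all $\phi\in V_q^h$,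 $f\in H^{q+1}(I)$, with $C_0$ independent of $h$ and $f$. **DG scheme.** For all $\phi,\psi\in V_q^h$, all $j=1,\dots,M$ and all $t$, $$\int_{I_j}(w_{1t}^h\phi+w_1^h\phi_x)\,dx+\sum_k\underline\omega_{k,j}N\big(w_1^h(x_{k,j}),w_2^h(x_{k,j})\big)w_2^h(x_{k,j})\phi(x_{k,j})=\widehat{w_1^h}\phi^-\big|_{j+\frac12}-\widehat{w_1^h}\phi^+\big|_{j-\frac12},$$ $$\int_{I_j}(w_{2t}^h\psi-w_2^h\psi_x)\,dx-\sum_k\underline\omega_{k,j}N\big(w_1^h(x_{k,j}),w_2^h(x_{k,j})\big)w_1^h(x_{k,j})\psi(x_{k,j})=\widetilde{w_2^h}\psi^+\big|_{j-\frac12}-\widetilde{w_2^h}\psi^-\big|_{j+\frac12}.$$ **Fluxes.** At interior nodes $x_{j+1/2}$, $j=1,\dots,M-1$: $$\widehat{w_1^h}=\{w_1^h\}-\frac{1-\alpha_1}{2}[w_1^h]+\frac{\beta_1}{2}[w_2^h],\qquad \widetilde{w_2^h}=\{w_2^h\}+\frac{1-\alpha_2}{2}[w_2^h]+\frac{\beta_2}{2}[w_1^h].$$ At the physical boundaries: $\widehat{w_1^h}(x_a,t)=w_1^{h,+}(x_a,t)$, $\widehat{w_1^h}(x_b,t)=0$, $\widetilde{w_2^h}(x_a,t)=0$, $\widetilde{w_2^h}(x_b,t)=w_2^{h,-}(x_b,t)$. *)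

(* Defs.v *)
From HB Require Import structures.
From mathcomp Require Import all_boot all_order all_algebra.
From mathcomp Require Import all_classical all_reals all_analysis.

Set Implicit Arguments.
Unset Strict Implicit.
Unset Printing Implicit Defensive.

Import Order.TTheory GRing.Theory Num.Theory.
Import numFieldNormedType.Exports.

Local Open Scope classical_set_scope.
Local Open Scope ring_scope.

(** Derivatives relative to a set [A]: on a closed interval they are one-sided
    at the end points and ordinary in the interior. *)

Definition diff_quot (R : realType) (f : R -> R) (t s : R) : R :=
  (f s - f t) / (s - t).

Definition derivable_in (R : realType) (A : set R) (f : R -> R) (t : R) : Prop :=
  cvg (diff_quot f t s @[s --> within A t^']).

Definition derive_in (R : realType) (A : set R) (f : R -> R) (t : R) : R :=
  lim (diff_quot f t s @[s --> within A t^']).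

Definition is_derive_in (R : realType) (A : set R) (f : R -> R) (t l : R) : Prop :=
  diff_quot f t s @[s --> within A t^'] --> l.

Definition nonlinearity (R : realType) (N : R -> R) (Ninf : R) : Prop :=
  [/\ N 0 = 1,
      N 1 = 0,
      forall r, 0 <= r ->
        derivable_in `[0, +oo[ N r /\ derive_in `[0, +oo[ N r < 0,
      N r @[r --> +oo] --> Ninf
    & Ninf < 0].

Definition N2 (R : realType) (N : R -> R) (a b : R) : R :=
  N (Num.sqrt (a ^+ 2 + b ^+ 2)).

(** Mesh nodes are numbered by integers: [x i] is the node x_{i+1/2}, for
    0 <= i <= M, and [elt x j] is the element I_{j+1}, for 0 <= j < M.  The
    values of [x] beyond [M] are irrelevant. *)

Definition elt (R : realType) (x : nat -> R) (j : nat) : set R :=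
  `]x j, x j.+1[.

Definition elt_size (R : realType) (x : nat -> R) (j : nat) : R :=
  x j.+1 - x j.

Definition mesh_size (R : realType) (M : nat) (x : nat -> R) : R :=
  \big[Num.max/elt_size x 0]_(j < M) elt_size x j.

Definition min_elt_size (R : realType) (M : nat) (x : nat -> R) : R :=
  \big[Num.min/elt_size x 0]_(j < M) elt_size x j.

Definition is_mesh (R : realType) (xa xb : R) (M : nat) (x : nat -> R) : Prop :=
  [/\ (0 < M)%N, x 0 = xa, x M = xb
    & forall j, (j < M)%N -> x j < x j.+1].

Definition quasi_uniform (R : realType) (zeta : R) (M : nat) (x : nat -> R) : Prop :=
  mesh_size M x / min_elt_size M x < zeta.

(** The space V_q^h; the values of its members at the nodes are arbitrary. *)
Definition dg_space (R : realType) (M : nat) (x : nat -> R) (q : nat) :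
    set (R -> R) :=
  [set v | forall j, (j < M)%N ->
    exists p : {poly R}, (size p <= q.+1)%N /\ forall y, elt x j y -> v y = p.[y]].

Definition vminus (R : realType) (v : R -> R) (y : R) : R :=
  lim (v z @[z --> y^'-]).
Definition vplus (R : realType) (v : R -> R) (y : R) : R :=
  lim (v z @[z --> y^'+]).
Definition jump (R : realType) (v : R -> R) (y : R) : R :=
  vminus v y - vplus v y.
Definition average (R : realType) (v : R -> R) (y : R) : R :=
  (vminus v y + vplus v y) / 2.

Definition inL2 (R : realType) (D : set R) (f : R -> R) : Prop :=
  measurable_fun D f /\
  ('N[@lebesgue_measure R]_2%:E[EFin \o (f \_ D)] < +oo)%E.

Definition L2norm (R : realType) (D : set R) (f : R -> R) : R :=
  fine ('N[@lebesgue_measure R]_2%:E[EFin \o (f \_ D)])%E.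

Definition test_function (R : realType) (a b : R) (phi : R -> R) : Prop :=
  (forall (n : nat) (y : R), derivable (derive1n n phi) y 1) /\
  exists c d : R, [/\ a < c, d < b & forall y, y \notin `[c, d] -> phi y = 0].

(** [v] is the weak derivative of order [k] of [u] on ]a, b[. *)
Definition weak_derivative (R : realType) (a b : R) (k : nat) (u v : R -> R) : Prop :=
  forall phi, test_function a b phi ->
    \int[@lebesgue_measure R]_(y in `]a, b[) (u y * derive1n k phi y) =
    (- 1) ^+ k * \int[@lebesgue_measure R]_(y in `]a, b[) (v y * phi y).

(** f belongs to H^m(]a, b[). *)
Definition sobolev (R : realType) (a b : R) (m : nat) (f : R -> R) : Prop :=
  inL2 `]a, b[ f /\
  forall k, (k <= m)%N -> exists g, inL2 `]a, b[ g /\ weak_derivative a b k f g.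

(** The rule on [elt x j] has [K j] nodes [xk j k] with weights [om j k],
    k < K j. *)
Definition quad (R : realType) (K : nat -> nat) (xk om : nat -> nat -> R)
    (j : nat) (f : R -> R) : R :=
  \sum_(k < K j) om j k * f (xk j k).

(** Point values of f in H^{q+1} are those of its continuous representative,
    and its seminorm is the L2 norm of its weak derivative [g] of order q+1. *)
Definition quadrature_rule (R : realType) (C0 : R) (xa xb : R) (M : nat)
    (x : nat -> R) (q : nat) (K : nat -> nat) (xk om : nat -> nat -> R) : Prop :=
  [/\ forall j k, (j < M)%N -> (k < K j)%N -> elt x j (xk j k) /\ 0 < om j k,
      forall j (p : {poly R}), (j < M)%N -> (size p <= q.+1)%N ->
        quad K xk om j (fun y => p.[y] ^+ 2) =
        \int[@lebesgue_measure R]_(y in elt x j) (p.[y] ^+ 2)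
    & forall phi f g : R -> R,
        dg_space M x q phi ->
        {within `[xa, xb], continuous f} ->
        sobolev xa xb q.+1 f ->
        inL2 `]xa, xb[ g -> weak_derivative xa xb q.+1 f g ->
        \sum_(j < M)
          `| quad K xk om j (fun y => phi y * f y)
             - \int[@lebesgue_measure R]_(y in elt x j) (phi y * f y) |
        <= C0 * mesh_size M x ^+ q.+1 * L2norm `[xa, xb] phi
             * L2norm `]xa, xb[ g].

(** Fluxes at the node [x i], 0 <= i <= M. *)

Definition flux1 (R : realType) (M : nat) (x : nat -> R) (alpha1 beta1 : R)
    (w1 w2 : R -> R) (i : nat) : R :=
  if i == 0%N then vplus w1 (x i)
  else if i == M then 0
  else average w1 (x i) - (1 - alpha1) / 2 * jump w1 (x i)
       + beta1 / 2 * jump w2 (x i).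

Definition flux2 (R : realType) (M : nat) (x : nat -> R) (alpha2 beta2 : R)
    (w1 w2 : R -> R) (i : nat) : R :=
  if i == 0%N then 0
  else if i == M then vminus w2 (x i)
  else average w2 (x i) + (1 - alpha2) / 2 * jump w2 (x i)
       + beta2 / 2 * jump w1 (x i).

(** Discrete unknowns are functions of time with values in functions of
    space. *)

Definition dt (R : realType) (T : R) (w : R -> R -> R) (t y : R) : R :=
  derive_in `[0, T] (w ^~ y) t.

Definition semidiscrete_function (R : realType) (T : R) (M : nat) (x : nat -> R)
    (q : nat) (w : R -> R -> R) : Prop :=
  (forall t : R, t \in `[0, T] -> dg_space M x q (w t)) /\
  (forall t j y, t \in `[0, T] -> (j < M)%N -> elt x j y ->
     derivable_in `[0, T] (w ^~ y) t).

Definition dg_scheme (R : realType) (T : R) (N : R -> R) (M : nat) (x : nat -> R)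
    (q : nat) (K : nat -> nat) (xk om : nat -> nat -> R)
    (alpha1 alpha2 beta1 beta2 : R) (w1 w2 : R -> R -> R) : Prop :=
  forall (phi psi : R -> R) (j : nat) (t : R),
    dg_space M x q phi -> dg_space M x q psi -> (j < M)%N -> t \in `[0, T] ->
    let f1 := flux1 M x alpha1 beta1 (w1 t) (w2 t) in
    let f2 := flux2 M x alpha2 beta2 (w1 t) (w2 t) in
    \int[@lebesgue_measure R]_(y in elt x j)
        (dt T w1 t y * phi y + w1 t y * derive1 phi y)
      + quad K xk om j (fun y => N2 N (w1 t y) (w2 t y) * w2 t y * phi y)
    = f1 j.+1 * vminus phi (x j.+1) - f1 j * vplus phi (x j)
    /\
    \int[@lebesgue_measure R]_(y in elt x j)
        (dt T w2 t y * psi y - w2 t y * derive1 psi y)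
      - quad K xk om j (fun y => N2 N (w1 t y) (w2 t y) * w1 t y * psi y)
    = f2 j * vplus psi (x j) - f2 j.+1 * vminus psi (x j.+1).

Definition energy (R : realType) (M : nat) (x : nat -> R) (w1 w2 : R -> R -> R)
    (t : R) : R :=
  \sum_(j < M) 2^-1 * \int[@lebesgue_measure R]_(y in elt x j)
                        (w1 t y ^+ 2 + w2 t y ^+ 2).

(* Main.v *)
Require Import Defs.
From HB Require Import structures.
From mathcomp Require Import all_boot all_order all_algebra.
From mathcomp Require Import all_classical all_reals all_analysis.
From mathcomp Require Import ring lra.
Import Order.TTheory GRing.Theory Num.Theory.
Import numFieldNormedType.Exports.
Local Open Scope classical_set_scope.
Local Open Scope ring_scope.
Set Implicit Arguments.
Unset Strict Implicit.

(** The identity is the energy method: at a fixed time the discrete solution is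
    itself an admissible test function, so the scheme may be tested with
    [phi = w1 t] and [psi = w2 t].  Added together, the two nonlinear terms
    [N * w2 * w1] and [- N * w1 * w2] cancel node by node in the quadrature sum.
    The transport terms [w * w'] are exact derivatives, so what remains on an element is a
    difference of two face terms [face_power], one at each end
    ([element_energy_balance]).  Regrouping these by nodes ([sum_by_nodes]), the
    two contributions at an interior node combine into a quadratic form in the
    jumps ([interior_face_power]), because [(v^-)^2 - (v^+)^2] equals
    [2 {v} [v]]; the end nodes give the boundary squares.

    The analytic point is that [w] is only known to be differentiable in time
    pointwise on each element.  Since [w t] is there a polynomial of degree at
    most [q], it is determined by its values at [q.+1] points; Lagrange
    interpolation at points that do not depend on time then shows that the time
    derivative is again polynomial in space and that the squared [L^2] norm,
    being a fixed quadratic form in these finitely many values, may be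
    differentiated under the integral sign ([element_time_derivative]).

    Under the condition on the parameters, Young's inequality makes the jump
    form nonpositive ([jump_form_le0]), and the mean value theorem turns the sign
    of the derivative into monotonicity of the energy
    ([is_derive_in_nonincreasing]). *)

(** * Derivatives relative to a set *)

Lemma eq_is_derive_in (R : realType) (A : set R) (f g : R -> R) (t l : R) :
  {in A, f =1 g} -> A t -> is_derive_in A f t l -> is_derive_in A g t l.
Proof.
move=> fg At; apply: cvg_trans; apply: near_eq_cvg.
rewrite near_withinE; near=> s => As.
by rewrite /diff_quot !fg ?inE.
Unshelve. all: by end_near. Qed.

Lemma is_derive_in_cvg (R : realType) (A : set R) (f : R -> R) (t l : R) :
  is_derive_in A f t l -> f s @[s --> within A t^'] --> f t.
Proof.
move=> fl.
have idt : s @[s --> within A t^'] --> t.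
  apply: cvg_within_filter; apply: cvg_within_filter; exact: cvg_id.
(* f s = f t + diff_quot f t s * (s - t) for s <> t *)
rewrite -[X in _ --> X]addr0 -(mulr0 l) -(subrr t).
have : f t + diff_quot f t s * (s - t) @[s --> within A t^'] -->
       f t + l * (t - t).
  apply: cvgD; first exact: cvg_cst.
  by apply: cvgM => //; apply: cvgB => //; exact: cvg_cst.
apply: cvg_trans; apply: near_eq_cvg.
rewrite near_withinE; near=> s => As.
rewrite /diff_quot mulfVK ?subrKC // subr_eq0.
by near: s; exact: nbhs_dnbhs_neq.
Unshelve. all: by end_near. Qed.

Lemma is_derive_inM (R : realType) (A : set R) (f g : R -> R) (t k l : R) :
  is_derive_in A f t k -> is_derive_in A g t l ->
  is_derive_in A (fun s => f s * g s) t (k * g t + f t * l).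
Proof.
move=> fk gl; have ft := is_derive_in_cvg fk.
have : diff_quot f t s * g t + f s * diff_quot g t s @[s --> within A t^'] -->
       k * g t + f t * l.
  by apply: cvgD; apply: cvgM => //; exact: cvg_cst.
rewrite /is_derive_in.
(* f s * g s - f t * g t = (f s - f t) * g t + f s * (g s - g t) *)
have <- // : (fun s => diff_quot f t s * g t + f s * diff_quot g t s) =
            diff_quot (fun s => f s * g s) t by apply/funext => s;
  rewrite /diff_quot; ring.
Qed.

Lemma is_derive_in_cst (R : realType) (A : set R) (c t : R) :
  is_derive_in A (fun=> c) t 0.
Proof.
rewrite /is_derive_in.
have -> : diff_quot (fun=> c) t = fun=> 0.
  by apply/funext => s; rewrite /diff_quot subrr mul0r.
exact: cvg_cst.
Qed.

Lemma is_derive_inMl (R : realType) (A : set R) (c : R) (f : R -> R) (t l : R) :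
  is_derive_in A f t l -> is_derive_in A (fun s => c * f s) t (c * l).
Proof.
move=> fl; have := is_derive_inM (is_derive_in_cst A c t) fl.
by rewrite mul0r add0r.
Qed.

Lemma is_derive_inD (R : realType) (A : set R) (f g : R -> R) (t k l : R) :
  is_derive_in A f t k -> is_derive_in A g t l ->
  is_derive_in A (fun s => f s + g s) t (k + l).
Proof.
move=> fk gl; have : diff_quot f t s + diff_quot g t s @[s --> within A t^'] -->
       k + l by apply: cvgD.
rewrite /is_derive_in.
have <- // : (fun s => diff_quot f t s + diff_quot g t s) =
            diff_quot (fun s => f s + g s) t by apply/funext => s;
  rewrite /diff_quot; ring.
Qed.

Lemma is_derive_in_sum (R : realType) (A : set R) (I : Type) (r : seq I)
    (f : I -> R -> R) (l : I -> R) (t : R) :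
  (forall i, is_derive_in A (f i) t (l i)) ->
  is_derive_in A (fun s => \sum_(i <- r) f i s) t (\sum_(i <- r) l i).
Proof.
move=> fl; elim: r => [|i r IHr].
  rewrite big_nil; under eq_fun do rewrite big_nil.
  exact: is_derive_in_cst.
rewrite big_cons; under eq_fun do rewrite big_cons.
exact: is_derive_inD.
Qed.

(** Makes limits of relative difference quotients unique at every point of the
    interval, end points included; only then does [derive_in], defined by a
    choice of limit, equal a derivative that has been computed. *)
Lemma within_itv_dnbhs_proper (R : realType) (a b t : R) :
  a < b -> t \in `[a, b] -> ProperFilter (within `[a, b] t^').
Proof.
move=> ab; rewrite in_itv /= => /andP[leat letb].
apply: Build_ProperFilter_ex => P [e /= e0 eP].
have [tltb|tgeb] := ltP t b.
  have m0 : 0 < Num.min (e / 2) (b - t).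
    by rewrite lt_min subr_gt0 tltb divr_gt0.
  (* step to the right of [t], staying below [b] *)
  exists (t + Num.min (e / 2) (b - t)).
  apply: eP => /=.
  - rewrite opprD addrA subrr sub0r normrN gtr0_norm // gt_min.
    by rewrite ltr_pdivrMr // ltr_pMr // ltr1n.
  - by rewrite -subr_eq0 addrAC subrr add0r gt_eqF.
  - have : Num.min (e / 2) (b - t) <= b - t by rewrite ge_min lexx orbT.
    by rewrite in_itv /= => ?; apply/andP; split; lra.
have tb : t = b by apply/eqP; rewrite eq_le letb.
rewrite {t leat letb tgeb}tb in eP.
have m0 : 0 < Num.min (e / 2) (b - a).
  by rewrite lt_min subr_gt0 ab divr_gt0.
(* at the right end point the only room is to the left *)
exists (b - Num.min (e / 2) (b - a)).
apply: eP => /=.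
- rewrite opprB addrC subrK gtr0_norm // gt_min.
  by rewrite ltr_pdivrMr // ltr_pMr // ltr1n.
- by rewrite -subr_eq0 addrAC subrr add0r oppr_eq0 gt_eqF.
- have : Num.min (e / 2) (b - a) <= b - a by rewrite ge_min lexx orbT.
  by rewrite in_itv /= => ?; apply/andP; split; lra.
Qed.

Lemma is_derive_in_interior (R : realType) (a b : R) (f : R -> R) (t l : R) :
  t \in `]a, b[ -> is_derive_in `[a, b] f t l -> is_derive t 1 f l.
Proof.
rewrite in_itv /= => /andP[lat ltb] fl.
have shiftt : h + t @[h --> (0 : R)^'] --> within `[a, b] t^'.
  move=> P [e /= e0 eP].
  change (\forall h \near (0 : R)^', P (h + t)).
  near=> h; apply: eP => /=.
  - rewrite opprD addrCA subrr addr0 normrN.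
    by near: h; exact: dnbhs0_lt.
  - by rewrite -subr_eq0 addrK; near: h; exact: nbhs_dnbhs_neq.
  - have : `|h| < Num.min (t - a) (b - t).
      by near: h; apply: dnbhs0_lt; rewrite lt_min !subr_gt0 lat.
    rewrite lt_min !ltr_norml in_itv /= => /andP[/andP[h1 h2] /andP[h3 h4]].
    by apply/andP; split; lra.
have h : h^-1 *: ((f \o shift t) (h *: (1:R)) - f t) @[h --> 0^'] --> l.
  have := cvg_comp _ _ shiftt fl; apply: cvg_trans.
  apply: near_eq_cvg; near=> h => /=.
  by rewrite /diff_quot addrK mulrC /= [h *: 1]mulr1.
apply: DeriveDef; last exact: cvg_lim.
by apply/cvg_ex; exists l.
Unshelve. all: by end_near. Qed.

(** The mean value theorem only needs ordinary derivatives in the interior,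
    where they agree with the relative ones, and continuity up to the end
    points, which follows from the one-sided derivatives there. *)
Lemma is_derive_in_nonincreasing (R : realType) (a b : R) (f df : R -> R) :
  (forall t, t \in `[a, b] -> is_derive_in `[a, b] f t (df t)) ->
  (forall t, t \in `[a, b] -> df t <= 0) ->
  {in `[a, b] &, {homo f : s t /~ s <= t}}.
Proof.
move=> fdf df0.
have oc t : t \in `]a, b[ -> t \in `[a, b] by exact: subset_itv_oo_cc.
have itd t : t \in `]a, b[ -> is_derive t 1 f (df t).
  by move=> tab; apply: (is_derive_in_interior tab); exact/fdf/oc.
apply: ler0_derive1_le_cc.
- by move=> t /itd [].
- by move=> t tab; have [_] := itd t tab; rewrite derive1E => ->; exact/df0/oc.
- apply/subspace_continuousP => t tab.
  have /is_derive_in_cvg ft := fdf t tab.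
  move=> P Pft; have [e /= e0 eP] := ft P Pft.
  exists e => //= s se As.
  have [->|st] := eqVneq s t; first exact: nbhs_singleton Pft.
  exact: eP.
Qed.

(** * Integrals of polynomials over an open interval *)

Definition poly_int (R : realType) (a b : R) (p : {poly R}) : R :=
  \int[@lebesgue_measure R]_(y in `]a, b[) p.[y].

Lemma integrable_horner (R : realType) (a b : R) (p : {poly R}) :
  (@lebesgue_measure R).-integrable `[a, b] (EFin \o horner p).
Proof.
apply: continuous_compact_integrable; first exact: segment_compact.
by apply: continuous_subspaceT; exact: continuous_horner.
Qed.

Lemma integrable_oo_horner (R : realType) (a b : R) (p : {poly R}) :
  (@lebesgue_measure R).-integrable `]a, b[ (EFin \o horner p).
Proof.
apply: integrableS (integrable_horner a b p) => //.
exact: subset_itv_oo_cc.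
Qed.

Lemma poly_int_linear (R : realType) (a b : R) : scalar (poly_int a b).
Proof.
move=> c p q; rewrite /poly_int.
under eq_Rintegral do rewrite hornerD hornerZ.
rewrite RintegralD //=; last exact: integrable_oo_horner.
- by rewrite RintegralZl //; exact: integrable_oo_horner.
- rewrite (_ : EFin \o _ = EFin \o horner (c *: p)); last first.
    by apply/funext => y /=; rewrite hornerZ.
  exact: integrable_oo_horner.
Qed.

HB.instance Definition _ (R : realType) (a b : R) :=
  GRing.isLinear.Build R {poly R} R *%R (poly_int a b) (@poly_int_linear R a b).

Lemma poly_int_deriv (R : realType) (a b : R) (p : {poly R}) :
  a < b -> poly_int a b p^`() = p.[b] - p.[a].
Proof.
move=> ab; rewrite /poly_int.
rewrite Rintegral_itv_bndo_bndc; last exact: integrable_oo_horner.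
rewrite Rintegral_itv_obnd_cbnd; last first.
  apply: integrableS (integrable_horner a b p^`()) => //.
  exact: subset_itv_oc_cc.
rewrite /Rintegral (@continuous_FTC2 _ _ (horner p)) //.
- by apply: continuous_subspaceT; exact: continuous_horner.
- split.
  + by move=> y _; exact: derivable_horner.
  + by apply: cvg_at_right_filter; exact: continuous_horner.
  + by apply: cvg_at_left_filter; exact: continuous_horner.
- by move=> y _; rewrite derivE.
Qed.

(** Integration by parts of a function against itself: [p * p'] is half the
    derivative of [p ^+ 2]. *)
Lemma poly_int_mul_deriv (R : realType) (a b : R) (p : {poly R}) :
  a < b -> poly_int a b (p * p^`()) = 2^-1 * (p.[b] ^+ 2 - p.[a] ^+ 2).
Proof.
move=> ab; have -> : p * p^`() = 2^-1 *: (p ^+ 2)^`().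
  rewrite expr2 derivM [p^`() * p]mulrC scalerDr -scalerDl.
  by rewrite (_ : 2^-1 + 2^-1 = 1) ?scale1r //; lra.
by rewrite linearZ /= poly_int_deriv // !horner_exp.
Qed.

(** * Functions that are polynomial on an open interval *)

(** Elements of the discretization space are only constrained inside the
    elements; everything the scheme extracts from them, namely integrals,
    traces and derivatives, depends on the polynomial alone. *)
Lemma eq_poly_int (R : realType) (a b : R) (f : R -> R) (p : {poly R}) :
  (forall y, `]a, b[%classic y -> f y = p.[y]) ->
  \int[@lebesgue_measure R]_(y in `]a, b[) f y = poly_int a b p.
Proof. by move=> fp; apply: eq_Rintegral => y; rewrite inE => /fp. Qed.

Lemma vplus_horner (R : realType) (a b : R) (f : R -> R) (p : {poly R}) :
  a < b -> (forall y, `]a, b[%classic y -> f y = p.[y]) -> vplus f a = p.[a].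
Proof.
move=> ab fp; apply: cvg_lim => //.
have : p.[z] @[z --> a^'+] --> p.[a].
  by apply: cvg_at_right_filter; exact: continuous_horner.
apply: cvg_trans; apply: near_eq_cvg; near=> z.
by rewrite fp //= in_itv /=; apply/andP; split; near: z;
  [exact: nbhs_right_gt|exact: nbhs_right_lt].
Unshelve. all: by end_near. Qed.

Lemma vminus_horner (R : realType) (a b : R) (f : R -> R) (p : {poly R}) :
  a < b -> (forall y, `]a, b[%classic y -> f y = p.[y]) -> vminus f b = p.[b].
Proof.
move=> ab fp; apply: cvg_lim => //.
have : p.[z] @[z --> b^'-] --> p.[b].
  by apply: cvg_at_left_filter; exact: continuous_horner.
apply: cvg_trans; apply: near_eq_cvg; near=> z.
by rewrite fp //= in_itv /=; apply/andP; split; near: z;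
  [exact: nbhs_left_gt|exact: nbhs_left_lt].
Unshelve. all: by end_near. Qed.

Lemma derive1_horner_oo (R : realType) (a b : R) (f : R -> R) (p : {poly R}) y :
  (forall y, `]a, b[%classic y -> f y = p.[y]) -> `]a, b[%classic y ->
  f^`()%classic y = p^`().[y].
Proof.
move=> fp aby; rewrite derivE !derive1E; apply: near_eq_derive.
have : \forall z \near y, `]a, b[%classic z.
  by apply: open_nbhs_nbhs; split=> //; exact: interval_open.
by apply: filterS => z; exact: fp.
Qed.

(** * Lagrange interpolation and time derivatives *)

(** The sequence is infinite because the Lagrange basis is indexed by an
    injective sequence over [nat], of which it uses an initial segment.  The
    offset 2 keeps every point strictly between [a] and [b]. *)
Definition interp_node (R : realType) (a b : R) (n : nat) : R := a + (b - a) / n.+2%:R.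

Lemma interp_node_in (R : realType) (a b : R) (n : nat) :
  a < b -> `]a, b[%classic (interp_node a b n).
Proof.
move=> ab; rewrite /= in_itv /= ltrDl divr_gt0 ?subr_gt0 //=.
by rewrite -ltrBrDl ltr_pdivrMr // ltr_pMr ?subr_gt0 // ltr1n.
Qed.

Lemma interp_node_inj (R : realType) (a b : R) : a < b -> injective (interp_node a b).
Proof.
move=> ab m n /addrI /mulfI; rewrite subr_eq0 gt_eqF // => /(_ isT).
by move/invr_inj/eqP; rewrite eqr_nat => /eqP [].
Qed.

(** Elements of the Lagrange basis have the type of polynomials of bounded size,
    with its own scaling; the type ascription makes [*:] below that of
    [{poly R}]. *)
Definition lagrange_poly (R : realType) (a b : R) (q : nat) (i : 'I_q.+1) :
    {poly R} :=
  tnth (q.+1.-lagrange (interp_node a b)) i.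

Definition interp (R : realType) (a b : R) (q : nat) (c : 'I_q.+1 -> R) :
    {poly R} :=
  \sum_(i < q.+1) c i *: lagrange_poly a b i.

Lemma interp_horner (R : realType) (a b : R) (q : nat) (p : {poly R}) :
  a < b -> (size p <= q.+1)%N ->
  interp a b (fun i : 'I_q.+1 => p.[interp_node a b i]) = p.
Proof.
move=> ab sp; rewrite [RHS](lagrange_gen _ (interp_node_inj ab) sp) // /interp.
by apply: eq_bigr => i _; rewrite mul_polyC.
Qed.

Lemma scalar_interp (R : realType) (a b : R) (q : nat) (c : 'I_q.+1 -> R)
    (f : {poly R} -> R) : scalar f ->
  f (interp a b c) =
  \sum_(i < q.+1) f (lagrange_poly a b i) * c i.
Proof.
move=> fP; pose fL := GRing.isLinear.Build R {poly R} R *%R f fP.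
pose g : {scalar {poly R}} := HB.pack f fL.
rewrite -[f]/(g : _ -> _) linear_sum; apply: eq_bigr => i _.
by rewrite linearZ /= mulrC.
Qed.

(** A linear functional of an interpolant is a fixed linear combination of the
    nodal values, so it commutes with the time derivative. *)
Lemma is_derive_in_interp (R : realType) (A : set R) (a b : R) (q : nat)
    (c : R -> 'I_q.+1 -> R) (dc : 'I_q.+1 -> R) (t : R)
    (f : {poly R} -> R) :
  scalar f -> (forall i, is_derive_in A (c ^~ i) t (dc i)) ->
  is_derive_in A (fun s => f (interp a b (c s))) t (f (interp a b dc)).
Proof.
move=> fP cdc; rewrite scalar_interp //.
under eq_fun do rewrite scalar_interp //.
by apply: is_derive_in_sum => i; exact: is_derive_inMl.
Qed.

Lemma scalar_poly_int_mul (R : realType) (a b : R) (r : {poly R}) :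
  scalar (fun p => poly_int a b (p * r)).
Proof. by move=> k u v; rewrite mulrDl -scalerAl linearP. Qed.

(** The squared norm of an interpolant is a quadratic form in the nodal values
    with constant coefficients (the Gram matrix of the Lagrange basis), so the
    product rule on finitely many terms suffices. *)
Lemma is_derive_in_interp_sqr (R : realType) (A : set R) (a b : R) (q : nat)
    (c : R -> 'I_q.+1 -> R) (dc : 'I_q.+1 -> R) (t : R) :
  (forall i, is_derive_in A (c ^~ i) t (dc i)) ->
  is_derive_in A (fun s => poly_int a b (interp a b (c s) ^+ 2)) t
    (2 * poly_int a b (interp a b dc * interp a b (c t))).
Proof.
move=> cdc.
pose l (i : 'I_q.+1) := lagrange_poly a b i.
have mulE (d : 'I_q.+1 -> R) (p : {poly R}) :
    poly_int a b (interp a b d * p) = \sum_(i < q.+1) poly_int a b (p * l i) * d i.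
  rewrite (scalar_interp a b d (@scalar_poly_int_mul _ a b p)).
  by apply: eq_bigr => i _; rewrite [l i * p]mulrC.
under eq_fun do rewrite expr2 mulE.
have -> : 2 * poly_int a b (interp a b dc * interp a b (c t)) =
    \sum_(i < q.+1) (poly_int a b (interp a b dc * l i) * c t i +
                     poly_int a b (interp a b (c t) * l i) * dc i).
  by rewrite big_split /= -!mulE [interp a b (c t) * _]mulrC mulr_natl mulr2n.
apply: is_derive_in_sum => i.
have intD := is_derive_in_interp (a := a) (b := b) (@scalar_poly_int_mul _ a b (l i)) cdc.
exact: is_derive_inM intD (cdc i).
Qed.

Lemma scalar_horner (R : realType) (y : R) : scalar (fun p : {poly R} => p.[y]).
Proof. by move=> k u v; rewrite hornerD hornerZ. Qed.

(** The polynomial [d] interpolates the pointwise time derivatives at the nodes.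
    Evaluation at any other point [y] is a linear functional of the nodal
    values, so uniqueness of the limit gives [dt T w t y = d.[y]] there too. *)
Lemma element_time_derivative (R : realType) (T a b : R) (q : nat)
    (w : R -> R -> R) (t : R) :
  0 < T -> a < b ->
  (forall s : R, s \in `[0, T] -> exists p : {poly R},
     (size p <= q.+1)%N /\ forall y, `]a, b[%classic y -> w s y = p.[y]) ->
  (forall y, `]a, b[%classic y -> derivable_in `[0, T] (w ^~ y) t) ->
  t \in `[0, T] ->
  exists2 d : {poly R}, forall y, `]a, b[%classic y -> dt T w t y = d.[y] &
    forall p : {poly R}, (forall y, `]a, b[%classic y -> w t y = p.[y]) ->
    is_derive_in `[0, T]
      (fun s => \int[@lebesgue_measure R]_(y in `]a, b[) w s y ^+ 2) t
      (2 * poly_int a b (d * p)).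
Proof.
move=> T0 ab wP wt tT.
pose c s (i : 'I_q.+1) := w s (interp_node a b i).
pose dc (i : 'I_q.+1) := dt T w t (interp_node a b i).
have wE (s : R) : s \in `[0, T] ->
    forall y, `]a, b[%classic y -> w s y = (interp a b (c s)).[y].
  move=> /wP [p [sp pE]] y aby; rewrite pE // -[in LHS](interp_horner ab sp).
  by congr (interp a b _).[y]; apply/funext => i; rewrite /c pE //; exact: interp_node_in.
have cdc i : is_derive_in `[0, T] (c ^~ i) t (dc i).
  exact: (wt _ (interp_node_in i ab)).
have properT := within_itv_dnbhs_proper T0 tT.
exists (interp a b dc) => [y aby|p pE].
  have wy : is_derive_in `[0, T] (w ^~ y) t (interp a b dc).[y].
    have := is_derive_in_interp (a := a) (b := b) (@scalar_horner R y) cdc.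
    apply: eq_is_derive_in => //.
    by move=> s; rewrite inE => sT; rewrite -wE.
  exact: cvg_lim wy.
have -> : poly_int a b (interp a b dc * p) =
          poly_int a b (interp a b dc * interp a b (c t)).
  by apply: eq_poly_int => y aby; rewrite !hornerM -pE // wE.
apply: eq_is_derive_in (is_derive_in_interp_sqr (a := a) (b := b) cdc) => // s.
rewrite inE => sT; symmetry; apply: eq_poly_int => y aby.
by rewrite horner_exp -wE.
Qed.

(** * Energy balance on an element and at the nodes *)

Lemma sum_by_nodes (R : comPzRingType) (M : nat) (F H : nat -> R) :
  (0 < M)%N ->
  \sum_(j < M) (F j.+1 - H j) = \sum_(1 <= i < M) (F i - H i) + F M - H 0%N.
Proof.
case: M => // m _; elim: m => [|m IHm].
  by rewrite big_ord_recl big_ord0 big_geq // addr0 add0r.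
rewrite big_ord_recr /= IHm [in RHS]big_nat_recr //=; ring.
Qed.

(** For fluxes [f1], [f2] and traces [v1], [v2] on one side of a node, this is the
    power that crosses the node on that side: the numerical flux minus half the
    physical one.  The second component is transported in the opposite
    direction, whence the opposite sign. *)
Definition face_power (R : realType) (f1 f2 v1 v2 : R) : R :=
  (f1 * v1 - v1 ^+ 2 / 2) - (f2 * v2 - v2 ^+ 2 / 2).

Lemma interior_face_power (R : realType) (alpha1 alpha2 beta1 beta2 : R)
  (M : nat) (x : nat -> R) (v1 v2 : R -> R) (i : nat) :
  (0 < i < M)%N ->
  let f1 := flux1 M x alpha1 beta1 v1 v2 i in
  let f2 := flux2 M x alpha2 beta2 v1 v2 i in
  face_power f1 f2 (vminus v1 (x i)) (vminus v2 (x i)) -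
  face_power f1 f2 (vplus v1 (x i)) (vplus v2 (x i)) =
  2^-1 * (- (1 - alpha1) * jump v1 (x i) ^+ 2
           - (1 - alpha2) * jump v2 (x i) ^+ 2
           + (beta1 - beta2) * jump v1 (x i) * jump v2 (x i)).
Proof.
move=> /andP[i0 iM] /=; rewrite /flux1 /flux2 gtn_eqF // ltn_eqF //.
rewrite /face_power /average /jump; by field.
Qed.

(** By Young's inequality [beta * a * b <= `|beta| / 2 * (a ^+ 2 + b ^+ 2)],
    and the hypothesis says that [`|beta| / 2] is at most the smaller of
    [1 - alpha1] and [1 - alpha2]. *)
Lemma jump_form_le0 (R : realFieldType) (alpha1 alpha2 beta a b : R) :
  - (1 - Num.max alpha1 alpha2) + `|beta| / 2 <= 0 ->
  - (1 - alpha1) * a ^+ 2 - (1 - alpha2) * b ^+ 2 + beta * a * b <= 0.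
Proof.
move=> h.
set m := Num.max _ _ in h.
have h1 : alpha1 <= m by rewrite /m le_max lexx.
have h2 : alpha2 <= m by rewrite /m le_max lexx orbT.
have young : beta * a * b <= `|beta| / 2 * (a ^+ 2 + b ^+ 2).
  apply: le_trans (ler_norm _) _; rewrite -mulrA normrM -mulrA.
  apply: ler_wpM2l => //; rewrite normrM -[a ^+ 2]real_normK ?num_real //.
  rewrite -[b ^+ 2]real_normK ?num_real //.
  have := sqr_ge0 (`|a| - `|b|); rewrite sqrrB; lra.
nra.
Qed.

(** Testing with the solution itself.  The two quadrature sums coincide, which is
    the discrete counterpart of [w1 * (- N w2) + w2 * (N w1) = 0]. *)
Lemma element_energy_balance (R : realType) (T : R) (N : R -> R) (M : nat)
    (x : nat -> R) (q : nat) (K : nat -> nat) (xk om : nat -> nat -> R)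
    (alpha1 alpha2 beta1 beta2 : R) (w1 w2 : R -> R -> R) (j : nat) (t : R) :
  0 < T -> x j < x j.+1 -> (j < M)%N -> t \in `[0, T] ->
  semidiscrete_function T M x q w1 ->
  semidiscrete_function T M x q w2 ->
  dg_scheme T N M x q K xk om alpha1 alpha2 beta1 beta2 w1 w2 ->
  let f1 := flux1 M x alpha1 beta1 (w1 t) (w2 t) in
  let f2 := flux2 M x alpha2 beta2 (w1 t) (w2 t) in
  is_derive_in `[0, T]
    (fun s => 2^-1 * \int[@lebesgue_measure R]_(y in elt x j)
                        (w1 s y ^+ 2 + w2 s y ^+ 2)) t
    (face_power (f1 j.+1) (f2 j.+1)
       (vminus (w1 t) (x j.+1)) (vminus (w2 t) (x j.+1)) -
     face_power (f1 j) (f2 j) (vplus (w1 t) (x j)) (vplus (w2 t) (x j))).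
Proof.
move=> T0 xj jM tT [w1V w1D] [w2V w2D] scheme f1 f2.
have [d1 dt1 E1] := element_time_derivative T0 xj
  (fun s sT => w1V s sT j jM) (fun y => w1D t j y tT jM) tT.
have [d2 dt2 E2] := element_time_derivative T0 xj
  (fun s sT => w2V s sT j jM) (fun y => w2D t j y tT jM) tT.
have [p1 [_ w1p]] := w1V t tT j jM.
have [p2 [_ w2p]] := w2V t tT j jM.
have [] := scheme (w1 t) (w2 t) j t (w1V t tT) (w2V t tT) jM tT.
rewrite -/f1 -/f2.
rewrite (@eq_poly_int _ _ _ _ (d1 * p1 + p1 * p1^`())); last first.
  move=> y yj; rewrite hornerD !hornerM dt1 // -w1p //.
  by rewrite (derive1_horner_oo w1p yj).
rewrite (@eq_poly_int _ _ _ _ (d2 * p2 - p2 * p2^`())); last first.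
  move=> y yj; rewrite hornerD hornerN !hornerM dt2 // -w2p //.
  by rewrite (derive1_horner_oo w2p yj).
rewrite linearD linearB /= !poly_int_mul_deriv //.
have -> : quad K xk om j (fun y => N2 N (w1 t y) (w2 t y) * w2 t y * w1 t y) =
          quad K xk om j (fun y => N2 N (w1 t y) (w2 t y) * w1 t y * w2 t y).
  by apply: eq_bigr => k _; rewrite mulrAC.
rewrite !(vplus_horner xj w1p, vplus_horner xj w2p,
          vminus_horner xj w1p, vminus_horner xj w2p).
set Q := quad _ _ _ _ _ => eq1 eq2.
have -> : face_power (f1 j.+1) (f2 j.+1) p1.[x j.+1] p2.[x j.+1] -
          face_power (f1 j) (f2 j) p1.[x j] p2.[x j] =
          2^-1 * (2 * poly_int (x j) (x j.+1) (d1 * p1) +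
                  2 * poly_int (x j) (x j.+1) (d2 * p2)).
  by rewrite /face_power; lra.
apply: is_derive_inMl.
apply: eq_is_derive_in (is_derive_inD (E1 p1 w1p) (E2 p2 w2p)) => // s.
rewrite inE => sT.
have [r1 [_ w1r]] := w1V s sT j jM.
have [r2 [_ w2r]] := w2V s sT j jM.
rewrite (@eq_poly_int _ _ _ _ (r1 ^+ 2)); last first.
  by move=> y yj; rewrite horner_exp w1r.
rewrite (@eq_poly_int _ _ _ _ (r2 ^+ 2)); last first.
  by move=> y yj; rewrite horner_exp w2r.
rewrite (@eq_poly_int _ _ _ _ (r1 ^+ 2 + r2 ^+ 2)) ?linearD //.
by move=> y yj; rewrite hornerD !horner_exp w1r // w2r.
Qed.

(** * Energy of the scheme *)

Definition energy_rate (R : realType) (M : nat) (x : nat -> R)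
    (alpha1 alpha2 beta1 beta2 : R) (v1 v2 : R -> R) : R :=
  2^-1 * \sum_(1 <= j < M)
     (- (1 - alpha1) * jump v1 (x j) ^+ 2
      - (1 - alpha2) * jump v2 (x j) ^+ 2
      + (beta1 - beta2) * jump v1 (x j) * jump v2 (x j))
   - 2^-1 * (vplus v1 (x 0%N) ^+ 2 + vplus v2 (x 0%N) ^+ 2
             + vminus v1 (x M) ^+ 2 + vminus v2 (x M) ^+ 2).

Lemma energy_rate_le0 (R : realType) (M : nat) (x : nat -> R)
    (alpha1 alpha2 beta1 beta2 : R) (v1 v2 : R -> R) :
  - (1 - Num.max alpha1 alpha2) + `|beta1 - beta2| / 2 <= 0 ->
  energy_rate M x alpha1 alpha2 beta1 beta2 v1 v2 <= 0.
Proof.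
move=> stable; rewrite subr_le0; apply: (@le_trans _ _ 0).
  rewrite pmulr_rle0 ?invr_gt0 //; apply: sumr_le0 => i _.
  exact: jump_form_le0.
by rewrite mulr_ge0 ?invr_ge0 // !addr_ge0 // sqr_ge0.
Qed.

Lemma sum_face_power (R : realType) (M : nat) (x : nat -> R)
    (alpha1 alpha2 beta1 beta2 : R) (v1 v2 : R -> R) :
  (0 < M)%N ->
  let f1 := flux1 M x alpha1 beta1 v1 v2 in
  let f2 := flux2 M x alpha2 beta2 v1 v2 in
  \sum_(j < M)
    (face_power (f1 j.+1) (f2 j.+1) (vminus v1 (x j.+1)) (vminus v2 (x j.+1)) -
     face_power (f1 j) (f2 j) (vplus v1 (x j)) (vplus v2 (x j))) =
  energy_rate M x alpha1 alpha2 beta1 beta2 v1 v2.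
Proof.
move=> M0 f1 f2.
pose F i := face_power (f1 i) (f2 i) (vminus v1 (x i)) (vminus v2 (x i)).
pose H i := face_power (f1 i) (f2 i) (vplus v1 (x i)) (vplus v2 (x i)).
rewrite (sum_by_nodes F H M0) /energy_rate mulr_sumr.
under eq_big_nat => i iM do rewrite /F /H interior_face_power //.
(* only the fluxes at the two physical boundaries are left *)
rewrite /F /H /f1 /f2 /flux1 /flux2 /= eqxx gtn_eqF // /face_power.
by field.
Qed.

Lemma is_derive_in_energy (R : realType) (T : R) (N : R -> R) (xa xb : R) (M : nat)
    (x : nat -> R) (q : nat) (K : nat -> nat) (xk om : nat -> nat -> R)
    (alpha1 alpha2 beta1 beta2 : R) (w1 w2 : R -> R -> R) (t : R) :
  0 < T -> is_mesh xa xb M x -> t \in `[0, T] ->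
  semidiscrete_function T M x q w1 ->
  semidiscrete_function T M x q w2 ->
  dg_scheme T N M x q K xk om alpha1 alpha2 beta1 beta2 w1 w2 ->
  is_derive_in `[0, T] (energy M x w1 w2) t
    (energy_rate M x alpha1 alpha2 beta1 beta2 (w1 t) (w2 t)).
Proof.
move=> T0 [M0 _ _ xlt] tT sd1 sd2 scheme; rewrite -sum_face_power //.
apply: is_derive_in_sum => j; apply: element_energy_balance sd1 sd2 scheme => //.
exact: xlt.
Qed.

Unset Implicit Arguments.

Theorem theorem1 (R : realType) (N : R -> R) (Ninf : R)
    (C0 zeta xa xb T : R) (M : nat) (x : nat -> R) (q : nat)
    (K : nat -> nat) (xk om : nat -> nat -> R)
    (alpha1 alpha2 beta1 beta2 : R) (w1 w2 : R -> R -> R) :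
  nonlinearity N Ninf ->
  0 < zeta -> 0 < T ->
  is_mesh xa xb M x ->
  quasi_uniform zeta M x ->
  quadrature_rule C0 xa xb M x q K xk om ->
  semidiscrete_function T M x q w1 ->
  semidiscrete_function T M x q w2 ->
  dg_scheme T N M x q K xk om alpha1 alpha2 beta1 beta2 w1 w2 ->
  (forall t : R, t \in `[0, T] ->
     is_derive_in `[0, T] (energy M x w1 w2) t
       (2^-1 * \sum_(1 <= j < M)
          (- (1 - alpha1) * jump (w1 t) (x j) ^+ 2
           - (1 - alpha2) * jump (w2 t) (x j) ^+ 2
           + (beta1 - beta2) * jump (w1 t) (x j) * jump (w2 t) (x j))
        - 2^-1 * (vplus (w1 t) (x 0%N) ^+ 2 + vplus (w2 t) (x 0%N) ^+ 2
                  + vminus (w1 t) (x M) ^+ 2 + vminus (w2 t) (x M) ^+ 2)))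
  /\
  (0 <= alpha1 <= 1 -> 0 <= alpha2 <= 1 ->
   - (1 - Num.max alpha1 alpha2) + `|beta1 - beta2| / 2 <= 0 ->
   forall t : R, t \in `[0, T] -> energy M x w1 w2 t <= energy M x w1 w2 0).
Proof.
move=> _ _ T0 mesh _ _ sd1 sd2 scheme.
have dE (t : R) (tT : t \in `[0, T]) :=
  is_derive_in_energy T0 mesh tT sd1 sd2 scheme.
split=> [|_ _ stable t tT]; first exact: dE.
apply: (is_derive_in_nonincreasing dE) => //.
- by move=> s _; exact: energy_rate_le0.
- by rewrite in_itv /= lexx ltW.
- by move: tT; rewrite in_itv /= => /andP[].
Qed.
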